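(* Let $p_1,p_2\in\mathbb{N}$. Let $(\mathfrak{X}_{11},\mathfrak{X}_{22})$ and $(\mathfrak{X}^\star_{11},\mathfrak{X}^\star_{22})$ be random pairs on $\mathcal{S}_{++}^{p_1}\times\mathcal{S}_{++}^{p_2}$ with identical marginal distributions (i.e., $\mathfrak{X}_{11}\overset{d}{=}\mathfrak{X}^\star_{11}$ and $\mathfrak{X}_{22}\overset{d}{=}\mathfrak{X}^\star_{22}$). Suppose $\mathfrak{X}^\star_{11}$ and $\mathfrak{X}^\star_{22}$ are independent and $(\mathfrak{X}_{11},\mathfrak{X}_{22})\preceq_{\mathrm{Lt}}(\mathfrak{X}^\star_{11},\mathfrak{X}^\star_{22})$. If $f:\mathcal{S}_{++}^{p_1}\to[0,\infty)$ and $g:\mathcal{S}_{++}^{p_2}\to[0,\infty)$ are matrix-variate Bernstein functions with triplets $(A_1,0,\mu_1)$ and $(A_2,0,\mu_2)$ respectively, then \[\mathbb{E}\{f(\mathfrak{X}_{11})g(\mathfrak{X}_{22})\}\ge\mathbb{E}\{f(\mathfrak{X}^\star_{11})\}\,\mathbb{E}\{g(\mathfrak{X}^\star_{22})\},\] provided that the expectations are finite.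
   Context: $\mathcal{S}_+^q$, $\mathcal{S}_{++}^q$: symmetric nonnegative definite / positive definite real $q\times q$ matrices; $\mathrm{etr}(\cdot)=\exp\{\mathrm{tr}(\cdot)\}$. A map $g:\mathcal{S}_{++}^q\to[0,\infty)$ is a matrix-variate Bernstein function with triplet $(A,B,\mu)$ if $A,B\in\mathcal{S}_+^q$, $\mu$ is a measure on $\mathcal{S}_{++}^q$ with $\int_{\mathcal{S}_{++}^q}\min[1,\{\mathrm{tr}(X^2)\}^{1/2}]\,\mu(\mathrm{d}X)<\infty$, and $g(T)=\mathrm{tr}(A)+\mathrm{tr}(BT)+\int_{\mathcal{S}_{++}^q}\{1-\mathrm{etr}(-TX)\}\,\mu(\mathrm{d}X)$ for all $T\in\mathcal{S}_{++}^q$. For random pairs on $\mathcal{S}_+^{p_1}\times\mathcal{S}_+^{p_2}$, $(\mathfrak{X}_1,\mathfrak{X}_2)\preceq_{\mathrm{Lt}}(\mathfrak{Y}_1,\mathfrak{Y}_2)$ means $\mathbb{E}\{\mathrm{etr}(-T_1\mathfrak{X}_1)\mathrm{etr}(-T_2\mathfrak{X}_2)\}\ge\mathbb{E}\{\mathrm{etr}(-T_1\mathfrak{Y}_1)\mathrm{etr}(-T_2\mathfrak{Y}_2)\}$ for all $T_1\in\mathcal{S}_+^{p_1}$, $T_2\in\mathcal{S}_+^{p_2}$. *)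

(* Defs.v *)
From HB Require Import structures.
From mathcomp Require Import all_boot all_algebra.
From mathcomp Require Import all_classical all_reals all_analysis.
Import GRing.Theory Num.Theory.
Local Open Scope ring_scope.
Local Open Scope classical_set_scope.

Set Implicit Arguments.
Unset Strict Implicit.
Unset Printing Implicit Defensive.

(* The carrier of real p x p matrices, given a pointed (choice) structure so that
   it can carry a sigma-algebra. *)
Definition mxc (R : realType) (p : nat) : Type := 'M[R]_p.
HB.instance Definition _ (R : realType) (p : nat) :=
  Choice.copy (mxc R p) 'M[R]_p.
HB.instance Definition _ (R : realType) (p : nat) :=
  isPointed.Build (mxc R p) (0 : 'M[R]_p).

Definition mx_gen (R : realType) (p : nat) : set (set (mxc R p)) :=
  [set (fun M : mxc R p => (M : 'M[R]_p) ij.1 ij.2) @^-1` B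
    | ij in [set: 'I_p * 'I_p] & B in [set B : set R | measurable B]].

(* Real p x p matrices with the Borel sigma-algebra of R^{p x p}
   (generated by the entries). *)
Definition mxm (R : realType) (p : nat) := g_sigma_algebraType (@mx_gen R p).
Definition mxm_display (R : realType) (p : nat) := sigma_display (@mx_gen R p).

Definition symmx (R : realType) (p : nat) (M : 'M[R]_p) : Prop := M^T = M.
Definition psdmx (R : realType) (p : nat) (M : 'M[R]_p) : Prop :=
  symmx M /\ forall v : 'cV[R]_p, 0 <= (v^T *m M *m v) 0 0.
Definition pdmx (R : realType) (p : nat) (M : 'M[R]_p) : Prop :=
  symmx M /\ forall v : 'cV[R]_p, v != 0 -> 0 < (v^T *m M *m v) 0 0.

Definition etr (R : realType) (p : nat) (M : 'M[R]_p) : R := expR (\tr M).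

Definition pdset (R : realType) (p : nat) : set (@mxm R p) :=
  [set M | pdmx (M : 'M[R]_p)].

(* g : S_++^p -> [0,oo) is a matrix-variate Bernstein function with triplet
   (A, B, mu), mu a measure on S_++^p (we take a measure on all matrices and
   only use its restriction to S_++^p). *)
Definition bernstein_triplet (R : realType) (p : nat) (g : 'M[R]_p -> R)
    (A B : 'M[R]_p) (mu : {measure set (mxm R p) -> \bar R}) : Prop :=
  [/\ psdmx A, psdmx B,
      (\int[mu]_(X in @pdset R p)
          (Num.min 1 (Num.sqrt (\tr ((X : 'M[R]_p) *m X))))%:E < +oo)%E,
      (forall T : 'M[R]_p, pdmx T -> 0 <= g T) &
      (forall T : 'M[R]_p, pdmx T ->
        (g T)%:E = ((\tr A)%:E + (\tr (B *m T))%:E +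
           \int[mu]_(X in @pdset R p) (1 - etr (- (T *m (X : 'M[R]_p))))%:E)%E)].

Definition Ex (R : realType) (d : measure_display) (O : measurableType d)
    (P : probability O R) (h : O -> R) : \bar R := (\int[P]_w (h w)%:E)%E.

(* Main.v *)
(* Write f(X) = tr A1 + \int phi(X, y) dm1(y) and g(X) = tr A2 + \int phi(X, z) dm2(z)
   with phi(X, y) = 1 - etr(- X y), which lies in [0, 1] because tr(X y) >= 0 for
   nonnegative definite X, y.  Expanding (1 - u)(1 - v), equality of the marginals
   and the Laplace order give
   E{phi(X11, y) phi(X22, z)} >= E{phi(X*11, y) phi(X*22, z)}, and independence
   factors the right-hand side.  By Tonelli this inequality survives integration in
   z and then in y, the constants tr A2 and tr A1 being handled by the equality of
   the marginals.  Tonelli needs sigma-finite measures: m1 and m2 are the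
   restrictions of mu1 and mu2 to the set where the integrand
   min(1, (tr X^2)^(1/2)) of the integrability condition is nonzero, outside of
   which phi vanishes. *)
Require Import Defs.
From HB Require Import structures.
From mathcomp Require Import all_boot all_order all_algebra ring.
From mathcomp Require Import all_classical all_reals all_analysis.
From mathcomp Require Import measurable_realfun.
Import Order.TTheory GRing.Theory Num.Theory.
Import numFieldNormedType.Exports.
Local Open Scope ring_scope.
Local Open Scope classical_set_scope.

Set Implicit Arguments.
Unset Strict Implicit.
Unset Printing Implicit Defensive.

(** * Quadratic forms and traces of nonnegative definite matrices *)

Definition qform {R : realType} {p} (M : 'M[R]_p) (u v : 'cV[R]_p) : R :=
  (u^T *m M *m v) 0 0.

Lemma qformC (R : realType) p (M : 'M[R]_p) u v :
  symmx M -> qform M u v = qform M v u.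
Proof.
move=> sM; rewrite /qform; transitivity ((u^T *m M *m v)^T 0 0).
  by rewrite [RHS]mxE.
by rewrite !trmx_mul trmxK sM mulmxA.
Qed.

Lemma qform_addZ (R : realType) p (M : 'M[R]_p) (t : R) u v : symmx M ->
  qform M (u + t *: v) (u + t *: v) =
  qform M u u + t * qform M u v *+ 2 + t ^+ 2 * qform M v v.
Proof.
move=> sM; have := qformC v u sM; rewrite /qform => vu.
have -> : (u + t *: v)^T = u^T + t *: v^T by rewrite linearD linearZ.
rewrite !mulmxDl !mulmxDr -!scalemxAr -!scalemxAl.
move: vu; move: (v^T *m M *m u) (u^T *m M *m u) => A B.
move: (v^T *m M *m v) (u^T *m M *m v) => C D AD.
by rewrite !mxE AD; ring.
Qed.

Lemma trmx_mul_self_ge0 (R : realType) m n (A : 'M[R]_(m, n)) :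
  0 <= \tr (A *m A^T).
Proof.
apply: sumr_ge0 => i _; rewrite mxE; apply: sumr_ge0 => j _.
by rewrite mxE -expr2 sqr_ge0.
Qed.

(** The trace is the sum of the squared entries of [A]. *)
Lemma trmx_mul_self_eq0 (R : realType) m n (A : 'M[R]_(m, n)) :
  \tr (A *m A^T) = 0 -> A = 0.
Proof.
move=> /eqP; rewrite psumr_eq0; last first.
  move=> i _; rewrite mxE; apply: sumr_ge0 => j _.
  by rewrite mxE -expr2 sqr_ge0.
move=> /allP A0; apply/matrixP => i j; rewrite mxE.
have := A0 i (mem_index_enum _); rewrite /= mxE psumr_eq0; last first.
  by move=> k _; rewrite mxE -expr2 sqr_ge0.
by move=> /allP /(_ j (mem_index_enum _)); rewrite /= mxE mulf_eq0 orbb => /eqP.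
Qed.

(** Along [M *m v + t *: v] the form is affine in t, because its quadratic coefficient [qform M v v]
    is zero. Its slope is twice the squared norm of [M *m v], and nonnegativity for all t forces
    that slope to vanish. *)
Lemma psd_isotropic (R : realType) p (M : 'M[R]_p) v :
  psdmx M -> qform M v v = 0 -> M *m v = 0.
Proof.
move=> [sM M0] v0; apply: trmx_mul_self_eq0.
have Mvv : qform M v (M *m v) = \tr (M *m v *m (M *m v)^T).
  by rewrite mxtrace_mulC /qform trmx_mul sM /mxtrace big_ord1.
rewrite -Mvv; apply/eqP/negPn/negP => c0.
set c := qform M v (M *m v) in c0.
set b := qform M (M *m v) (M *m v).
(* This value of t solves b + 2ct = -1, so the form would be negative. *)
have := M0 (M *m v + (- (b + 1) / (c *+ 2)) *: v).
rewrite -/(qform _ _ _) qform_addZ // v0 mulr0 addr0 qformC // -/b -/c.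
have -> : b + - (b + 1) / (c *+ 2) * c *+ 2 = -1 by field.
by rewrite ler0N1.
Qed.

(** The new form at u is the minimum over t of the form of [M] at [u + t *: v], attained at t = -
    [qform M u v] / [qform M v v]; hence it is nonnegative. *)
Lemma psd_sub_rank1 (R : realType) p (M : 'M[R]_p) v :
  psdmx M -> 0 < qform M v v ->
  psdmx (M - (qform M v v)^-1 *: (M *m v *m (M *m v)^T)).
Proof.
move=> [sM M0] v0; split=> [|u].
  by rewrite /symmx linearB linearZ /= trmx_mul trmxK sM.
have := M0 (u + (- qform M u v / qform M v v) *: v).
rewrite -/(qform _ _ _) qform_addZ //.
have -> : (u^T *m (M - (qform M v v)^-1 *: (M *m v *m (M *m v)^T)) *m u) 0 0 =
    qform M u u - (qform M v v)^-1 * (qform M u v * qform M u v).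
  rewrite {2}(qformC u v sM) mulmxBr mulmxBl -scalemxAr -scalemxAl trmx_mul sM.
  rewrite !mulmxA -2!(mulmxA (u^T *m M *m v)) /qform.
  move: (u^T *m M *m u) (u^T *m M *m v) (v^T *m M *m u) => A B C.
  by rewrite !mxE big_ord1.
set a := qform M u u; set b := qform M u v; set c := qform M v v in v0 *.
suff -> : a - c^-1 * (b * b) = a + - b / c * b *+ 2 + (- b / c) ^+ 2 * c by [].
by field; rewrite gt_eqF.
Qed.

Lemma pd_psd (R : realType) p (M : 'M[R]_p) : pdmx M -> psdmx M.
Proof.
move=> [sM M0]; split=> // v; have [->|/M0/ltW//] := eqVneq v 0.
by rewrite mulmx0 mxE.
Qed.

Lemma psd0 (R : realType) p : psdmx (0 : 'M[R]_p).
Proof. by split=> [|v]; rewrite /symmx ?trmx0// mulmx0 mul0mx mxE. Qed.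

Lemma qform_delta (R : realType) p (M : 'M[R]_p) i j :
  qform M (delta_mx i 0) (delta_mx j 0) = M i j.
Proof. by rewrite /qform trmx_delta -rowE -colE !mxE. Qed.

Lemma psd_trace_ge0 (R : realType) p (M : 'M[R]_p) : psdmx M -> 0 <= \tr M.
Proof.
by move=> [_ M0]; apply: sumr_ge0 => i _; rewrite -qform_delta; exact: M0.
Qed.

(* Induction on the number k of possibly nonzero rows of M: subtracting
   (M e_k)(M e_k)^T / M_kk from M clears row k and keeps M nonnegative
   definite, and the trace of T against the subtracted matrix is
   (M e_k)^T T (M e_k) / M_kk. *)
Lemma psd_trace_mul_ge0 (R : realType) p (T M : 'M[R]_p) :
  psdmx T -> psdmx M -> 0 <= \tr (T *m M).
Proof.
move=> [_ T0].
suff H k : forall M : 'M[R]_p, psdmx M ->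
    (forall i j : 'I_p, (k <= i)%N -> M i j = 0) -> 0 <= \tr (T *m M).
  (* At k = p the condition on the rows is vacuous. *)
  by move=> psdM; apply: (H p) => // i j; rewrite leqNgt ltn_ord.
elim: k => [|k IH] {}M psdM Mk.
  suff -> : M = 0 by rewrite mulmx0 mxtrace0.
  by apply/matrixP => i j; rewrite Mk// mxE.
have [kp|pk] := ltnP k p; last first.
  by apply: IH => // i j ki; have := leq_trans pk ki; rewrite leqNgt ltn_ord.
pose e : 'cV[R]_p := delta_mx (Ordinal kp) 0.
have [sM M0] := psdM; have := M0 e; rewrite -/(qform _ _ _).
rewrite le_eqVlt => /orP[/eqP/esym c0|c0].
  (* With a zero pivot nothing is subtracted: [e] is isotropic, so row k of [M] is already zero. *)
  apply: IH => // i j; rewrite leq_eqVlt => /orP[/eqP ki|]; last exact: Mk.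
  have -> : i = Ordinal kp by apply/val_inj; rewrite /= ki.
  have /matrixP/(_ j 0) := psd_isotropic psdM c0.
  by rewrite -colE -[in LHS]sM !mxE.
have psdM' := psd_sub_rank1 psdM c0.
set c := qform M e e in c0 psdM' *; set N := _ - _ in psdM'.
have -> : M = N + c^-1 *: (M *m e *m (M *m e)^T) by rewrite subrK.
rewrite mulmxDr mxtraceD addr_ge0//.
  (* Rows after k stay zero; in row k the pivot [c] is the diagonal entry of [M], so the two terms
     cancel. *)
  apply: IH => // i j; rewrite /N -colE !mxE big_ord1 !mxE leq_eqVlt.
  move=> /orP[/eqP ki|ki]; last by rewrite !(Mk i)// mul0r mulr0 subr0.
  have -> : i = Ordinal kp by apply/val_inj; rewrite /= ki.
  have -> : M j (Ordinal kp) = M (Ordinal kp) j by rewrite -[in LHS]sM mxE.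
  rewrite mulrA -[M (Ordinal kp) (Ordinal kp)]qform_delta -/e -/c mulVf.
    by rewrite mul1r subrr.
  by rewrite gt_eqF.
rewrite -scalemxAr mxtraceZ mulr_ge0 ?invr_ge0 ?(ltW c0)//.
by rewrite mulmxA mxtrace_mulC mulmxA /mxtrace big_ord1 T0.
Qed.

(** A row of the left kernel gives an isotropic vector, which definiteness excludes; conversely an
    isotropic vector lies in the kernel by [psd_isotropic]. This trades the strict inequalities for
    one polynomial condition in the entries. *)
Lemma pdmxE (R : realType) p (M : 'M[R]_p) :
  pdmx M <-> psdmx M /\ \det M != 0.
Proof.
split=> [pM|[psdM dM]].
  split; first exact: pd_psd.
  rewrite -unitfE -unitmxE -row_free_unit -kermx_eq0.
  apply/eqP/row_matrixP => i; rewrite row0; set v := row i _.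
  have vM : v *m M = 0 by apply/sub_kermxP; rewrite row_sub.
  apply/eqP/negPn/negP; rewrite -trmx_eq0 => /(pM.2 v^T).
  by rewrite trmxK vM mul0mx mxE ltxx.
split=> [|v v0]; first exact: psdM.1.
rewrite lt_neqAle psdM.2 andbT; apply: contraNneq v0 => /esym q0.
have := psd_isotropic psdM q0; rewrite -[v]mul1mx => /(congr1 (mulmx (invmx M))).
by rewrite mul1mx mulmx0 mulKmx ?unitmxE ?unitfE// => ->.
Qed.

(** * Borel measurability of the positive definite set and of matrix operations *)

Lemma qformE (R : realType) p (M : 'M[R]_p) u v :
  qform M u v = \sum_i \sum_j u j 0 * M j i * v i 0.
Proof.
rewrite /qform mxE; apply: eq_bigr => i _; rewrite mxE big_distrl /=.
by apply: eq_bigr => j _; rewrite mxE.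
Qed.

(** Each coordinate of v is approximated from below by rationals within 1/(n+1), and the form is
    continuous. Countably many inequalities thus suffice, as measurability requires. *)
Lemma qform_ge0_rat (R : realType) p (M : 'M[R]_p) :
  (forall v : 'cV[rat]_p, 0 <= qform M (map_mx ratr v) (map_mx ratr v)) ->
  forall v, 0 <= qform M v v.
Proof.
move=> M0 v.
have /choice[q qv] (z : 'I_p * nat) :
    exists r : rat, ratr r \in `]v z.1 0 - z.2.+1%:R^-1, v z.1 0[%R.
  by apply: rat_in_itvoo; rewrite ltrBlDr ltrDl invr_gt0 ltr0n.
pose w n : 'cV[rat]_p := \col_i q (i, n).
have wv i : (map_mx ratr (w n) : 'cV[R]_p) i 0 @[n --> \oo] --> v i 0.
  apply: (@squeeze_cvgr _ _ _ _ (fun n => v i 0 - n.+1%:R^-1) (cst (v i 0))).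
  - near=> n; have := qv (i, n); rewrite in_itv /= !mxE => /andP[/ltW -> /ltW].
    by [].
  - rewrite -[X in _ --> X]subr0; apply: cvgB; first exact: cvg_cst.
    exact: cvg_harmonic.
  - exact: cvg_cst.
have wMw : qform M (map_mx ratr (w n)) (map_mx ratr (w n)) @[n --> \oo] -->
    qform M v v.
  under eq_fun do rewrite qformE.
  rewrite qformE; apply: cvg_big => [x|i _]; first exact: add_continuous.
  apply: cvg_big => [x|j _]; first exact: add_continuous.
  by apply: cvgM; [apply: cvgM; [|exact: cvg_cst]|].
rewrite -(cvg_lim _ wMw)//; apply: limr_ge; first by apply/cvg_ex; eexists; exact: wMw.
by near=> n.
Unshelve. all: by end_near. Qed.

Lemma measurable_mxm_entry d (T : measurableType d) (R : realType) p
    (F : T -> mxm R p) i j : measurable_fun setT F ->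
  measurable_fun setT (fun x => (F x : 'M[R]_p) i j).
Proof.
move=> mF _ B mB; apply: (mF measurableT ((fun M : 'M[R]_p => M i j) @^-1` B)).
by apply: sub_sigma_algebra; exists (i, j) => //; exists B.
Qed.

Lemma measurable_mxmP d (T : measurableType d) (R : realType) p
    (F : T -> mxm R p) :
  (forall i j, measurable_fun setT (fun x => (F x : 'M[R]_p) i j)) ->
  measurable_fun setT F.
Proof.
move=> mF; apply: (@measurability _ _ T (mxm R p) setT F (@mx_gen R p)) => //.
move=> _ [_ [[i j] _ [B mB <-]] <-].
by have := mF i j measurableT B mB.
Qed.

Lemma measurable_mulmx d (T : measurableType d) (R : realType) p
    (F G : T -> mxm R p) :
  measurable_fun setT F -> measurable_fun setT G ->
  measurable_fun setT
    (fun x => ((F x : 'M[R]_p) *m (G x : 'M[R]_p) : mxm R p)).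
Proof.
move=> mF mG; apply: measurable_mxmP => i j.
under eq_fun do rewrite mxE.
apply: measurable_sum => k; apply: measurable_funM.
  exact: measurable_mxm_entry.
exact: measurable_mxm_entry.
Qed.

Lemma measurable_mxtrace d (T : measurableType d) (R : realType) p
    (F : T -> mxm R p) : measurable_fun setT F ->
  measurable_fun setT (fun x => \tr (F x : 'M[R]_p)).
Proof.
move=> mF; apply: measurable_sum => i.
exact: measurable_mxm_entry.
Qed.

(** The complement is a countable union of measurable sets: a negative value at some rational
    vector, an asymmetric pair of entries, or a zero determinant. *)
Lemma measurable_pdset (R : realType) p : measurable (@pdset R p).
Proof.
have mE i j := measurable_mxm_entry i j (@measurable_id _ (mxm R p) setT).
pose neg (v : 'cV[rat]_p) : set (mxm R p) :=
  [set M : mxm R p | qform (M : 'M[R]_p) (map_mx ratr v) (map_mx ratr v) < 0].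
pose asym (ij : 'I_p * 'I_p) : set (mxm R p) :=
  [set M : mxm R p | (M : 'M[R]_p) ij.1 ij.2 != (M : 'M[R]_p) ij.2 ij.1].
pose sing : set (mxm R p) := [set M : mxm R p | \det (M : 'M[R]_p) == 0].
have -> : @pdset R p = ~` (\bigcup_v neg v `|` \bigcup_ij asym ij `|` sing).
  apply/seteqP; split=> [M /pdmxE[[sM M0] dM]|M].
    move=> [[[v _]|[[i j] _]]|]; rewrite /neg /asym /sing /=.
    - by rewrite ltNge M0.
    - have -> : M i j = M j i by rewrite -[in LHS]sM mxE.
      by rewrite eqxx.
    - by rewrite (negbTE dM).
  move=> /not_orP[/not_orP[nneg nasym] /negP nsing]; apply/pdmxE; split=> //.
  split.
    apply/matrixP => i j; rewrite mxE; apply/eqP/negPn/negP => ne.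
    by apply: nasym; exists (j, i).
  apply: qform_ge0_rat => v; rewrite leNgt; apply/negP => lt0.
  by apply: nneg; exists v.
have mset (b : mxm R p -> bool) : measurable_fun setT b ->
    measurable [set M | b M].
  move=> mb; have := mb measurableT [set true] Logic.I.
  by rewrite setTI; congr (measurable _); apply/seteqP.
apply: measurableC; apply: measurableU; first apply: measurableU.
- apply: countable_bigcupT_measurable => [|v]; first exact: countableP.
  apply: mset; apply: measurable_fun_ltr => //.
  under eq_fun do rewrite qformE.
  apply: measurable_sum => i; apply: measurable_sum => j.
  by apply: measurable_funM => //; exact: measurable_funM.
- apply: countable_bigcupT_measurable => [|ij]; first exact: countableP.
  by apply: mset; apply: measurable_neg; apply: measurable_fun_eqr.
- apply: mset; apply: measurable_fun_eqr => //; apply: measurable_sum => s.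
  by apply: measurable_funM => //; apply: measurable_prod.
Qed.

(** * Sigma-finite restriction, Tonelli and image measures *)

Section measure_lemmas.
Local Open Scope ereal_scope.

(** By Markov's inequality each set where h is at least 1/(n+1) has finite measure, and these sets
    exhaust the support of h. *)
Lemma sigma_finite_mrestr_support d (T : measurableType d) (R : realType)
    (mu : {measure set T -> \bar R}) (h : T -> \bar R)
    (mD : measurable [set x | h x != 0]) :
  measurable_fun setT h -> (forall x, 0 <= h x) -> \int[mu]_x h x < +oo ->
  sigma_finite setT (mrestr mu mD).
Proof.
move=> mh h0 hoo; pose E n := [set x | n.+1%:R^-1%:E <= h x].
have mE n : measurable (E n).
  by rewrite /E -[X in measurable X]setTI; exact: emeasurable_fun_c_infty.
have Eoo n : mu (E n) < +oo.
  have n0 : (0 < n.+1%:R^-1 :> R)%R by rewrite invr_gt0 ltr0n.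
  have := @le_integral_comp_abse _ _ _ mu setT measurableT h n.+1%:R^-1%R id
    (@measurable_id _ _ _) (fun _ => id) (fun _ _ _ _ => id) mh n0.
  under eq_integral do rewrite gee0_abs//.
  have -> : [set x | n.+1%:R^-1%:E <= `|h x|] = E n.
    by apply/seteqP; split=> x; rewrite /E /= gee0_abs.
  rewrite setTI.
  move=> /le_lt_trans/(_ hoo) /=.
  have := measure_ge0 mu (E n).
  case: (mu (E n)) => [r||]//=; first by move=> *; rewrite ltry.
  by move=> _; rewrite gt0_muley ?ltxx// lte_fin.
(* The complement of the support is null for the restricted measure; adding it makes the sets cover
   the whole space. *)
exists (fun n => E n `|` ~` [set x | h x != 0]) => [|n]; last first.
  split; first by apply: measurableU => //; exact: measurableC.
  apply: le_lt_trans (Eoo n); rewrite /mrestr setIUl setICl setU0.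
  by apply: le_measure; rewrite ?inE//; exact: measurableI.
apply/esym/seteqP; split=> // x _.
have [hx|hx] := eqVneq (h x) 0; first by exists 0%N => //; right => /=; rewrite hx eqxx.
have : 0 < h x by rewrite lt0e hx h0.
case hxE: (h x) => [r| |]// r0; last by exists 0%N => //; left; rewrite /E /= hxE leey.
have [n nr] := ltr_add_invr r0.
by exists n => //; left; rewrite /E /= hxE lee_fin ltW// -[X in (X < _)%R]add0r.
Qed.

(* A measure with respect to which some h has a finite integral may be replaced
   by a sigma-finite one when integrating functions that vanish where h does. *)
Lemma sigma_finite_replacement d (T : measurableType d) (R : realType)
    (mu : {measure set T -> \bar R}) (h : T -> \bar R) :
  measurable_fun setT h -> (forall x, 0 <= h x) -> \int[mu]_x h x < +oo ->
  exists m : {sigma_finite_measure set T -> \bar R},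
  forall k : T -> \bar R, (forall x, h x = 0 -> k x = 0) ->
  \int[mu]_x k x = \int[m]_x k x.
Proof.
move=> mh h0 hoo.
have mD : measurable [set x | h x != 0].
  by rewrite -[X in measurable X]setTI; exact: emeasurable_neq.
pose sf := Measure_isSigmaFinite.Build _ _ _ (mrestr mu mD)
  (sigma_finite_mrestr_support mD mh h0 hoo).
pose m : {sigma_finite_measure set T -> \bar R} := HB.pack (mrestr mu mD) sf.
exists m => k k0.
have -> : k = k \_ [set x | h x != 0].
  apply/funext => x; rewrite patchE; case: ifPn => //; rewrite notin_setE /=.
  by move=> /negP; rewrite negbK => /eqP/k0.
rewrite -!integral_mkcond; apply: eq_measure_integral => A mA AD /=.
by rewrite /mrestr setIidl.
Qed.

(** One mixing step: an inequality known for each y is integrated over y by Tonelli, while [w] and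
    [c] carry the other factor. The bound on [c * Ps setT] takes care of the constant [a]. *)
Lemma mixture_le d ds dS (O : measurableType d) (Os : measurableType ds)
    (S : measurableType dS) (R : realType)
    (P : {sigma_finite_measure set O -> \bar R})
    (Ps : {sigma_finite_measure set Os -> \bar R})
    (m : {sigma_finite_measure set S -> \bar R})
    (k : O * S -> \bar R) (ks : Os * S -> \bar R) (w : O -> \bar R)
    (a c : \bar R) :
  measurable_fun setT k -> (forall z, 0 <= k z) ->
  measurable_fun setT ks -> (forall z, 0 <= ks z) ->
  measurable_fun setT w -> (forall x, 0 <= w x) -> 0 <= a -> 0 <= c ->
  c * Ps setT <= \int[P]_x w x ->
  (forall y, c * \int[Ps]_x ks (x, y) <= \int[P]_x (k (x, y) * w x)) ->
  c * \int[Ps]_x (a + \int[m]_y ks (x, y)) <=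
  \int[P]_x ((a + \int[m]_y k (x, y)) * w x).
Proof.
move=> mk k0 mks ks0 mw w0 a0 c0 cw ckw.
have mkw : measurable_fun setT (fun z : O * S => k z * w z.1).
  by apply: emeasurable_funM => //; exact: measurableT_comp.
have kw0 z : 0 <= k z * w z.1 by rewrite mule_ge0.
have mK := measurable_fun_fubini_tonelli_F (m2 := m) k mk k0.
have mKs := measurable_fun_fubini_tonelli_F (m2 := m) ks mks ks0.
have mKG := measurable_fun_fubini_tonelli_G (m1 := Ps) ks mks ks0.
have mkwG := measurable_fun_fubini_tonelli_G (m1 := P) _ mkw kw0.
have mky x : measurable_fun setT (fun y => k (x, y)).
  exact: measurableT_comp mk (measurable_pair1 _).
rewrite ge0_integralD//; last by move=> x _; exact: integral_ge0.
rewrite integral_cst// ge0_muleDr ?mule_ge0 ?integral_ge0//; last first.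
  by move=> x _; exact: integral_ge0.
have -> : \int[P]_x ((a + \int[m]_y k (x, y)) * w x) =
    a * \int[P]_x w x + \int[m]_y \int[P]_x (k (x, y) * w x).
  transitivity (\int[P]_x (a * w x + \int[m]_y (k (x, y) * w x))).
    apply: eq_integral => x _; rewrite ge0_muleDl ?integral_ge0//.
    by rewrite ge0_integralZr.
  rewrite ge0_integralD//; first last.
  - exact: (measurable_fun_fubini_tonelli_F _ mkw kw0).
  - by move=> x _; apply: integral_ge0 => y _; exact: kw0 (x, y).
  - exact: emeasurable_funM.
  - by move=> x _; rewrite mule_ge0.
  by rewrite ge0_integralZl// (fubini_tonelli _ mkw kw0).
apply: leeD; first by rewrite muleCA lee_wpmul2l.
rewrite (fubini_tonelli _ mks ks0) -ge0_integralZl//; last first.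
  by move=> y _; exact: integral_ge0.
apply: ge0_le_integral => //.
- by move=> y _; rewrite mule_ge0// integral_ge0.
- exact: emeasurable_funM.
Qed.

(** Both sides integrate u against image measures, which coincide. *)
Lemma ge0_integral_comp_eq d ds dT (O : measurableType d)
    (Os : measurableType ds) (T : measurableType dT) (R : realType)
    (P : {measure set O -> \bar R}) (Ps : {measure set Os -> \bar R})
    (X : O -> T) (Xs : Os -> T) (u : T -> \bar R) :
  measurable_fun setT X -> measurable_fun setT Xs ->
  (forall B, measurable B -> P (X @^-1` B) = Ps (Xs @^-1` B)) ->
  measurable_fun setT u -> (forall x, 0 <= u x) ->
  \int[P]_w u (X w) = \int[Ps]_w u (Xs w).
Proof.
move=> mX mXs PX mu u0.
have := @ge0_integral_pushforward _ _ _ _ _ _ mX P setT u measurableT mu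
  (fun y _ => u0 y).
have := @ge0_integral_pushforward _ _ _ _ _ _ mXs Ps setT u measurableT mu
  (fun y _ => u0 y).
rewrite !preimage_setT => <- <-.
by apply: eq_measure_integral => A mA _; exact: PX.
Qed.

(** The joint law agrees with the product of the marginal laws on rectangles, hence everywhere;
    Tonelli then factors the integral. *)
Lemma ge0_integralM_indep d d1 d2 (O : measurableType d)
    (T1 : measurableType d1) (T2 : measurableType d2) (R : realType)
    (P : probability O R) (X1 : O -> T1) (X2 : O -> T2)
    (u : T1 -> \bar R) (v : T2 -> \bar R) :
  measurable_fun setT X1 -> measurable_fun setT X2 ->
  (forall B1 B2, measurable B1 -> measurable B2 ->
     P (X1 @^-1` B1 `&` X2 @^-1` B2) = P (X1 @^-1` B1) * P (X2 @^-1` B2)) ->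
  measurable_fun setT u -> (forall x, 0 <= u x) ->
  measurable_fun setT v -> (forall x, 0 <= v x) ->
  \int[P]_w (u (X1 w) * v (X2 w)) =
  \int[P]_w u (X1 w) * \int[P]_w v (X2 w).
Proof.
move=> mX1 mX2 indep mu u0 mv v0.
pose Y1 : {mfun O >-> T1} := HB.pack X1 (isMeasurableFun.Build _ _ _ _ X1 mX1).
pose Y2 : {mfun O >-> T2} := HB.pack X2 (isMeasurableFun.Build _ _ _ _ X2 mX2).
have mX12 : measurable_fun setT (fun w => (X1 w, X2 w)).
  exact: measurable_fun_pair.
pose Y : {mfun O >-> (T1 * T2)%type} :=
  HB.pack (fun w => (X1 w, X2 w)) (isMeasurableFun.Build _ _ _ _ _ mX12).
have muv : measurable_fun setT (fun z : T1 * T2 => u z.1 * v z.2).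
  by apply: emeasurable_funM; exact: measurableT_comp.
have uv0 z : 0 <= u z.1 * v z.2 by rewrite mule_ge0.
rewrite -[LHS](@ge0_integral_distribution _ _ _ _ _ P Y _ muv uv0).
rewrite -(@ge0_integral_distribution _ _ _ _ _ P Y1 u mu u0).
rewrite -(@ge0_integral_distribution _ _ _ _ _ P Y2 v mv v0).
transitivity (\int[distribution P Y1 \x distribution P Y2]_z (u z.1 * v z.2)).
  apply: eq_measure_integral => A mA _; apply/esym.
  by apply: product_measure_unique => // B1 B2 mB1 mB2; exact: indep.
rewrite fubini_tonelli1// /fubini_F /=.
under eq_integral do rewrite ge0_integralZl//.
by rewrite ge0_integralZr// integral_ge0.
Qed.

End measure_lemmas.

Lemma le_integral_one_sub_mul d ds (O : measurableType d)
    (Os : measurableType ds) (R : realType) (P : probability O R)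
    (Ps : probability Os R) (e1 e2 : O -> R) (es1 es2 : Os -> R) :
  measurable_fun setT e1 -> measurable_fun setT e2 ->
  measurable_fun setT es1 -> measurable_fun setT es2 ->
  (forall x, 0 <= e1 x <= 1) -> (forall x, 0 <= e2 x <= 1) ->
  (forall x, 0 <= es1 x <= 1) -> (forall x, 0 <= es2 x <= 1) ->
  (\int[P]_x (e1 x)%:E = \int[Ps]_x (es1 x)%:E)%E ->
  (\int[P]_x (e2 x)%:E = \int[Ps]_x (es2 x)%:E)%E ->
  (\int[Ps]_x (es1 x * es2 x)%:E <= \int[P]_x (e1 x * e2 x)%:E)%E ->
  (\int[Ps]_x ((1 - es1 x) * (1 - es2 x))%:E <=
   \int[P]_x ((1 - e1 x) * (1 - e2 x))%:E)%E.
Proof.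
move=> me1 me2 mes1 mes2 b1 b2 bs1 bs2 E1 E2 E12.
(* The expansion is kept in additive form, so that all terms are nonnegative and no subtraction of
   extended reals occurs. *)
have H d' (T : measurableType d') (Q : probability T R) (u v : T -> R) :
    measurable_fun setT u -> measurable_fun setT v ->
    (forall x, 0 <= u x <= 1) -> (forall x, 0 <= v x <= 1) ->
    (\int[Q]_x ((1 - u x) * (1 - v x))%:E + (\int[Q]_x (u x)%:E +
     \int[Q]_x (v x)%:E) = 1 + \int[Q]_x (u x * v x)%:E)%E.
  move=> mu mv bu bv.
  have mc : measurable_fun setT (fun x => (1 - u x) * (1 - v x)).
    by apply: measurable_funM; apply: measurable_funB.
  have u0 x : 0 <= u x by case/andP: (bu x).
  have v0 x : 0 <= v x by case/andP: (bv x).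
  have c0 x : 0 <= (1 - u x) * (1 - v x).
    by case/andP: (bu x) => _ ?; case/andP: (bv x) => _ ?; rewrite mulr_ge0 ?subr_ge0.
  have <- : (\int[Q]_x 1%:E = 1)%E.
    by rewrite integral_cst// mul1e; exact: probability_setT.
  rewrite -!ge0_integralD//.
  - apply: eq_integral => x _; rewrite -[RHS]/((1 + u x * v x)%:E).
    have -> : 1 + u x * v x = (1 - u x) * (1 - v x) + (u x + v x) by ring.
    by [].
  - by move=> x _; rewrite lee_fin mulr_ge0.
  - by apply/measurable_EFinP; exact: measurable_funM.
  - by move=> x _; rewrite lee_fin.
  - exact/measurable_EFinP.
  - by move=> x _; rewrite adde_ge0 ?lee_fin.
  - by apply: emeasurable_funD; exact/measurable_EFinP.
  - by move=> x _; rewrite lee_fin.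
  - exact/measurable_EFinP.
  - by move=> x _; rewrite lee_fin.
  - exact/measurable_EFinP.
have fin (u : Os -> R) : measurable_fun setT u -> (forall x, 0 <= u x <= 1) ->
    (\int[Ps]_x (u x)%:E)%E \is a fin_num.
  move=> mu bu; rewrite ge0_fin_numE; last first.
    by apply: integral_ge0 => x _; rewrite lee_fin; case/andP: (bu x).
  apply: (@le_lt_trans _ _ (\int[Ps]_x 1%:E)%E); last first.
    by rewrite integral_cst// mul1e [X in (X < _)%E]probability_setT ltry.
  apply: ge0_le_integral => //.
  - by move=> x _; rewrite lee_fin; case/andP: (bu x).
  - exact/measurable_EFinP.
  - by move=> x _; rewrite lee_fin; case/andP: (bu x).
(* The sum of the two single integrals is common to both sides and finite, so it cancels. *)
have := leeD2l 1%E E12; rewrite -!H// E1 E2 leeD2rE//.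
by rewrite fin_numD !fin.
Qed.

(** * The Laplace kernel on clipped matrices *)

(** The default 0 is nonnegative definite and makes [1 - etr_clip x y] vanish as soon as x or y is
    not positive definite. *)
Definition pdclip {R : realType} {p} (y : mxm R p) : mxm R p :=
  if `[< @pdset R p y >] then y else (0 : 'M[R]_p).

Lemma psd_pdclip (R : realType) p (y : mxm R p) :
  psdmx (pdclip y : 'M[R]_p).
Proof. by rewrite /pdclip; case: asboolP => [/pd_psd//|_]; exact: psd0. Qed.

Lemma pdclip_id (R : realType) p (y : mxm R p) :
  pdmx (y : 'M[R]_p) -> pdclip y = y.
Proof. by move=> pdy; rewrite /pdclip asboolT. Qed.

Lemma measurable_pdclip (R : realType) p :
  measurable_fun setT (@pdclip R p).
Proof.
apply: measurable_fun_ifT => //; apply: (measurable_fun_bool true).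
rewrite setTI; suff -> : (fun y => `[< @pdset R p y >]) @^-1` [set true] =
  @pdset R p by exact: measurable_pdset.
by apply/seteqP; split => y /asboolP.
Qed.

(* Clipping both arguments makes the bounds 0 <= etr_clip <= 1 hold on all of
   'M_p x 'M_p, so that no domain has to be carried through the integrals. *)
Definition etr_clip {R : realType} {p} (x y : mxm R p) : R :=
  etr (- ((pdclip x : 'M[R]_p) *m (pdclip y : 'M[R]_p))).

Lemma etr_clip_bound (R : realType) p (x y : mxm R p) :
  0 <= etr_clip x y <= 1.
Proof.
rewrite /etr_clip /etr expR_ge0 /= -expR0 ler_expR raddfN oppr_le0.
exact: psd_trace_mul_ge0 (psd_pdclip _) (psd_pdclip _).
Qed.

Lemma measurable_etr_clip d (T : measurableType d) (R : realType) p
    (F G : T -> mxm R p) :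
  measurable_fun setT F -> measurable_fun setT G ->
  measurable_fun setT (fun z => etr_clip (F z) (G z)).
Proof.
move=> mF mG; rewrite /etr_clip /etr; apply: measurableT_comp => //.
under eq_fun do rewrite raddfN; apply: measurableT_comp => //.
by apply: measurable_mxtrace; apply: measurable_mulmx;
  apply: measurableT_comp => //; exact: measurable_pdclip.
Qed.

Lemma bernstein_sigma_finite (R : realType) p (f : 'M[R]_p -> R)
    (A : 'M[R]_p) (mu : {measure set (mxm R p) -> \bar R}) :
  bernstein_triplet f A 0 mu ->
  exists m : {sigma_finite_measure set (mxm R p) -> \bar R},
  forall x : 'M[R]_p, pdmx x ->
  ((f x)%:E = (\tr A)%:E + \int[m]_y (1 - etr_clip (x : mxm R p) y)%:E)%E.
Proof.
move=> [_ _ mu_fin _ fE].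
pose h0 (y : mxm R p) := Num.min 1 (Num.sqrt (\tr ((y : 'M[R]_p) *m y))).
pose h := (EFin \o h0) \_ (@pdset R p).
have h00 y : 0 <= h0 y by rewrite /h0 le_min ler01 sqrtr_ge0.
have mh : measurable_fun setT h.
  apply/measurable_restrict => //; first exact: measurable_pdset.
  apply: measurable_funTS; apply/measurable_EFinP; apply: measurable_minr => //.
  apply: (measurableT_comp (continuous_measurable_fun (@sqrt_continuous R))).
  by apply: measurable_mxtrace; exact: measurable_mulmx.
have h_ge0 y : (0 <= h y)%E.
  by rewrite /h patchE; case: ifPn => // _; rewrite lee_fin.
have hoo : (\int[mu]_y h y < +oo)%E by rewrite /h -integral_mkcond.
have [m mE] := sigma_finite_replacement mh h_ge0 hoo; exists m => x pdx.
rewrite fE// mul0mx mxtrace0 adde0 integral_mkcond -mE => [|y].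
  congr (_ + _)%E; apply: eq_integral => y _; rewrite patchE /etr_clip pdclip_id//.
  case: ifPn; first by rewrite inE => /pdclip_id ->.
  rewrite notin_setE => npd; rewrite /pdclip asboolF// mulmx0 oppr0.
  by rewrite /etr mxtrace0 expR0 subrr.
rewrite /h patchE /etr_clip; case: ifPn; last first.
  rewrite notin_setE => npd _; rewrite /pdclip (asboolF npd) mulmx0 oppr0.
  by rewrite /etr mxtrace0 expR0 subrr.
(* For symmetric y, a zero of [h0] has tr(y y^T) = 0, hence y = 0, where the kernel vanishes. This
   also covers p = 0, where the zero matrix is positive definite. *)
rewrite inE => pdy [h0y]; suff -> : pdclip y = (0 : 'M[R]_p) :> 'M[R]_p.
  by rewrite mulmx0 oppr0 /etr mxtrace0 expR0 subrr.
rewrite pdclip_id//; apply: trmx_mul_self_eq0; rewrite [X in _ *m X]pdy.1.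
have y0 : 0 <= \tr ((y : 'M[R]_p) *m y).
  by rewrite -[X in _ *m X]pdy.1 trmx_mul_self_ge0.
apply/eqP; rewrite eq_le y0 andbT -sqrtr_eq0; move: h0y; rewrite /h0 minElt.
by case: ifPn => [_ /eqP|_ ->//]; rewrite oner_eq0.
Qed.

(** * The product inequality, by two successive mixing steps *)

Theorem theorem3p12 (R : realType) (p1 p2 : nat)
  (d : measure_display) (O : measurableType d) (P : probability O R)
  (ds : measure_display) (Os : measurableType ds) (Ps : probability Os R)
  (X11 : O -> mxm R p1) (X22 : O -> mxm R p2)
  (Xs11 : Os -> mxm R p1) (Xs22 : Os -> mxm R p2)
  (mX11 : measurable_fun setT X11) (mX22 : measurable_fun setT X22)
  (mXs11 : measurable_fun setT Xs11) (mXs22 : measurable_fun setT Xs22)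
  (pdX11 : forall w, pdmx (X11 w : 'M[R]_p1))
  (pdX22 : forall w, pdmx (X22 w : 'M[R]_p2))
  (pdXs11 : forall w, pdmx (Xs11 w : 'M[R]_p1))
  (pdXs22 : forall w, pdmx (Xs22 w : 'M[R]_p2))
  (* identical marginal distributions *)
  (marg1 : forall B : set (mxm R p1), measurable B ->
     P (X11 @^-1` B) = Ps (Xs11 @^-1` B))
  (marg2 : forall B : set (mxm R p2), measurable B ->
     P (X22 @^-1` B) = Ps (Xs22 @^-1` B))
  (* independence of Xs11 and Xs22 *)
  (indep : forall (B1 : set (mxm R p1)) (B2 : set (mxm R p2)),
     measurable B1 -> measurable B2 ->
     Ps (Xs11 @^-1` B1 `&` Xs22 @^-1` B2) =
     (Ps (Xs11 @^-1` B1) * Ps (Xs22 @^-1` B2))%E)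
  (* Laplace-transform order *)
  (Lt : forall (T1 : 'M[R]_p1) (T2 : 'M[R]_p2), psdmx T1 -> psdmx T2 ->
     (Ex P (fun w => (etr (- (T1 *m (X11 w : 'M[R]_p1))) *
                     etr (- (T2 *m (X22 w : 'M[R]_p2))))%R)
      >= Ex Ps (fun w => (etr (- (T1 *m (Xs11 w : 'M[R]_p1))) *
                         etr (- (T2 *m (Xs22 w : 'M[R]_p2))))%R))%E)
  (f : 'M[R]_p1 -> R) (g : 'M[R]_p2 -> R)
  (A1 : 'M[R]_p1) (mu1 : {measure set (mxm R p1) -> \bar R})
  (A2 : 'M[R]_p2) (mu2 : {measure set (mxm R p2) -> \bar R})
  (hf : bernstein_triplet f A1 0 mu1)
  (hg : bernstein_triplet g A2 0 mu2)
  (fin1 : (Ex P (fun w => (f (X11 w) * g (X22 w))%R) < +oo)%E)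
  (fin2 : (Ex Ps (fun w => f (Xs11 w)) < +oo)%E)
  (fin3 : (Ex Ps (fun w => g (Xs22 w)) < +oo)%E) :
  (Ex P (fun w => (f (X11 w) * g (X22 w))%R)
   >= Ex Ps (fun w => f (Xs11 w)) * Ex Ps (fun w => g (Xs22 w)))%E.
Proof.
have [A1_ge0 A2_ge0] : 0 <= \tr A1 /\ 0 <= \tr A2.
  by case: hf hg => [pA1 _ _ _ _] [pA2 _ _ _ _]; split; exact: psd_trace_ge0.
have [m1 fE] := bernstein_sigma_finite hf.
have [m2 gE] := bernstein_sigma_finite hg.
pose phi p (x y : mxm R p) : \bar R := (1 - etr_clip x y)%:E.
have phi_ge0 p (x y : mxm R p) : (0 <= phi p x y)%E.
  by rewrite lee_fin subr_ge0; case/andP: (etr_clip_bound x y).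
have mphi d' (T : measurableType d') p (F G : T -> mxm R p) :
    measurable_fun setT F -> measurable_fun setT G ->
    measurable_fun setT (fun z => phi p (F z) (G z)).
  move=> mF mG; apply/measurable_EFinP; apply: measurable_funB => //.
  exact: measurable_etr_clip.
have mphi_pair d' (T : measurableType d') p (F : T -> mxm R p) :
    measurable_fun setT F ->
    measurable_fun setT (fun z : T * mxm R p => phi p (F z.1) z.2).
  by move=> mF; apply: mphi => //; exact: measurableT_comp.
(* [G] agrees with g on positive definite matrices, but is nonnegative and measurable on all
   matrices. *)
pose G (x : mxm R p2) : \bar R := ((\tr A2)%:E + \int[m2]_y phi p2 x y)%E.
have G_ge0 x : (0 <= G x)%E.
  by rewrite adde_ge0 ?lee_fin// integral_ge0.
have mG : measurable_fun setT G.
  apply: emeasurable_funD => //.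
  apply: (measurable_fun_fubini_tonelli_F (fun z => phi p2 z.1 z.2)) => //.
  exact: (mphi_pair _ _ _ id).
have -> : Ex P (fun w => f (X11 w) * g (X22 w)) =
    (\int[P]_w (((\tr A1)%:E + \int[m1]_y phi p1 (X11 w) y) * G (X22 w)))%E.
  by apply: eq_integral => w _; rewrite EFinM fE// gE.
have -> : Ex Ps (fun w => g (Xs22 w)) = (\int[Ps]_w G (Xs22 w))%E.
  by apply: eq_integral => w _; rewrite gE.
have -> : Ex Ps (fun w => f (Xs11 w)) =
    (\int[Ps]_w ((\tr A1)%:E + \int[m1]_y phi p1 (Xs11 w) y))%E.
  by apply: eq_integral => w _; rewrite fE.
rewrite muleC.
have mGX : measurable_fun setT (fun w => G (X22 w)).
  exact: measurableT_comp mG mX22.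
have mGXs : measurable_fun setT (fun w => G (Xs22 w)).
  exact: measurableT_comp mG mXs22.
(* First mixing, over [m1]: the weight is [G (X22 w)] and the constant is the integral of
   [G (Xs22 w)]. *)
apply: (mixture_le m1 (mphi_pair _ _ _ _ mX11) (fun _ => phi_ge0 _ _ _)
  (mphi_pair _ _ _ _ mXs11) (fun _ => phi_ge0 _ _ _) mGX (fun _ => G_ge0 _)).
- by rewrite lee_fin.
- by apply: integral_ge0 => w _; exact: G_ge0.
- rewrite [X in (_ * X <= _)%E](probability_setT Ps) mule1.
  by rewrite (ge0_integral_comp_eq mX22 mXs22 marg2 mG G_ge0).
move=> y.
have mphiy : measurable_fun setT (fun x => phi p1 x y) by exact: mphi.
have mphiX : measurable_fun setT (fun w => phi p1 (X11 w) y) by exact: mphi.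
(* With y fixed the roles are exchanged: the second mixing is over [m2], with weight
   [phi p1 (X11 w) y]. *)
rewrite muleC; under [leRHS]eq_integral do rewrite muleC.
apply: (mixture_le m2 (mphi_pair _ _ _ _ mX22) (fun _ => phi_ge0 _ _ _)
  (mphi_pair _ _ _ _ mXs22) (fun _ => phi_ge0 _ _ _) mphiX
  (fun _ => phi_ge0 _ _ _)).
- by rewrite lee_fin.
- by apply: integral_ge0 => w _; exact: phi_ge0.
- rewrite [X in (_ * X <= _)%E](probability_setT Ps) mule1.
  by rewrite (ge0_integral_comp_eq mX11 mXs11 marg1 mphiy (fun _ => phi_ge0 _ _ _)).
move=> z.
have mphiz : measurable_fun setT (fun x => phi p2 x z) by exact: mphi.
under [leRHS]eq_integral do rewrite muleC.
(* Independence merges the product of the two starred integrals into one integral of a product. *)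
rewrite -(ge0_integralM_indep mXs11 mXs22 indep mphiy (fun _ => phi_ge0 _ _ _)
  mphiz (fun _ => phi_ge0 _ _ _)).
apply: (le_integral_one_sub_mul (e1 := fun w => etr_clip (X11 w) y)
  (e2 := fun w => etr_clip (X22 w) z) (es1 := fun w => etr_clip (Xs11 w) y)
  (es2 := fun w => etr_clip (Xs22 w) z)); try exact: measurable_etr_clip;
  try by move=> w; exact: etr_clip_bound.
- apply: (ge0_integral_comp_eq (u := fun x => (etr_clip x y)%:E) mX11 mXs11 marg1).
    by apply/measurable_EFinP; exact: measurable_etr_clip.
  by move=> x; rewrite lee_fin; case/andP: (etr_clip_bound x y).
- apply: (ge0_integral_comp_eq (u := fun x => (etr_clip x z)%:E) mX22 mXs22 marg2).
    by apply/measurable_EFinP; exact: measurable_etr_clip.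
  by move=> x; rewrite lee_fin; case/andP: (etr_clip_bound x z).
(* By cyclicity of the trace the kernels take the form used in the Laplace order, with arguments
   [pdclip y] and [pdclip z]. *)
have etr_clipE p (x y' : mxm R p) : pdmx (x : 'M[R]_p) ->
    etr_clip x y' = etr (- ((pdclip y' : 'M[R]_p) *m (x : 'M[R]_p))).
  by move=> pdx; rewrite /etr_clip /etr pdclip_id// !raddfN /= mxtrace_mulC.
have etr_clip2 d' (T : measurableType d') (Q : probability T R)
    (X1 : T -> mxm R p1) (X2 : T -> mxm R p2) :
    (forall w, pdmx (X1 w : 'M[R]_p1)) -> (forall w, pdmx (X2 w : 'M[R]_p2)) ->
    (\int[Q]_w (etr_clip (X1 w) y * etr_clip (X2 w) z)%:E)%E =
    Ex Q (fun w => etr (- ((pdclip y : 'M[R]_p1) *m (X1 w : 'M[R]_p1))) *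
                   etr (- ((pdclip z : 'M[R]_p2) *m (X2 w : 'M[R]_p2)))).
  by move=> pd1 pd2; apply: eq_integral => w _; rewrite !etr_clipE.
rewrite (etr_clip2 _ _ _ _ _ pdXs11 pdXs22) (etr_clip2 _ _ _ _ _ pdX11 pdX22).
exact: Lt (psd_pdclip y) (psd_pdclip z).
Qed.
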